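(* The optimal density of a $(3,2)$ broadcast for $H_{\infty,\infty}$ satisfies \[\delta_{3,2}(H_{\infty,\infty})\leq \frac{1}{6}.\]
   Context: The infinite truncated square tiling graph $H_{\infty,\infty}$ has vertex set $\{(a,(x,y)) : a\in\mathbb{Z}_4,\ (x,y)\in\mathbb{Z}^2\}$. Its edges are: $(a,(x,y))\sim(a+1,(x,y))$ with $a+1$ taken modulo 4 (so each $(x,y)$ carries a 4-cycle whose vertices $0,1,2,3$ are its top, right, bottom, left vertices); $(1,(x,y))\sim(3,(x+1,y))$; and $(0,(x,y))\sim(2,(x,y+1))$. For $(x,y)\in\mathbb{Z}^2$ the octagon $O_{x,y}$ is the 8-cycle through $(0,(x,y)),(1,(x,y)),(3,(x+1,y)),(0,(x+1,y)),(2,(x+1,y+1)),(3,(x+1,y+1)),(1,(x,y+1)),(2,(x,y+1))$, in this cyclic order. For a graph $G$ and integers $1\le r\le t$, a set $T\subseteq V(G)$ is a $(t,r)$ broadcast of $G$ if every $u\in V(G)$ satisfies $\sum_{v\in T,\ d(u,v)<t}(t-d(u,v))\ge r$, where $d$ is the graph distance in $G$. The broadcast density of a $(t,r)$ broadcast $T$ for $H_{\infty,\infty}$ is $\lim_{n\to\infty}|T\cap V(B_n)|/|V(B_n)|$, where $B_n$ is the finite portion of the graph given by the union of the octagons $O_{x,y}$ with $-n\le x,y\le n-1$. The optimal density $\delta_{t,r}(H_{\infty,\infty})$ is the minimum (infimum) of the broadcast densities over all $(t,r)$ broadcasts $T$ of $H_{\infty,\infty}$ for which the limit exists. *)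

(* Defs.v *)
(* MathComp-Analysis development, over an arbitrary realType. *)
From HB Require Import structures.
From mathcomp Require Import all_boot all_order all_algebra finmap.
From mathcomp Require Import all_classical all_reals all_analysis.

Set Implicit Arguments.
Unset Strict Implicit.
Unset Printing Implicit Defensive.

Import Order.TTheory GRing.Theory Num.Theory.
Import numFieldNormedType.Exports.

Local Open Scope classical_set_scope.
Local Open Scope ring_scope.

(* A graph is a symmetric irreflexive relation e : rel V on its vertices. *)

(* The distance is valued in \bar R: it is +oo when no walk joins u to v. *)
Definition graph_dist (R : realType) (V : choiceType) (e : rel V) (u v : V) :
    \bar R :=
  ereal_inf [set ((size p)%:R%:E : \bar R) |
             p in [set p : seq V | path e u p /\ last u p = v]].

Definition reception (R : realType) (V : choiceType) (e : rel V) (t : nat)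
    (u v : V) : \bar R :=
  ((t%:R : R)%:E - graph_dist R e u v)%E.

Definition broadcast (R : realType) (V : choiceType) (e : rel V) (t r : nat)
    (T : set V) : Prop :=
  forall u : V,
    ((r%:R : R)%:E <=
     \esum_(v in [set v | T v /\ (graph_dist R e u v < (t%:R : R)%:E)%E])
       reception R e t u v)%E.

Definition tsq_vertex : choiceType := ('Z_4 * (int * int))%type.

Definition mkv (a : 'Z_4) (x y : int) : tsq_vertex := (a, (x, y)).

Definition tsq_arc : rel tsq_vertex := fun u v =>
  let: (a, (x, y)) := u in
  [|| v == mkv (a + 1) x y,
      (a == 1) && (v == mkv 3 (x + 1) y)
    | (a == 0) && (v == mkv 2 x (y + 1))].

Definition tsq_adj : rel tsq_vertex := fun u v => tsq_arc u v || tsq_arc v u.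

Lemma tsq_adj_sym : symmetric tsq_adj.
Proof. by move=> u v; rewrite /tsq_adj orbC. Qed.

Lemma tsq_adj_irr : irreflexive tsq_adj.
Proof.
move=> [a [x y]]; rewrite /tsq_adj orbb /= /mkv !xpair_eqE.
by case: a => [[|[|[|[|a]]]] //=] ia.
Qed.

Definition octagon (x y : int) : seq tsq_vertex :=
  [:: mkv 0 x y; mkv 1 x y; mkv 3 (x + 1) y; mkv 0 (x + 1) y;
      mkv 2 (x + 1) (y + 1); mkv 3 (x + 1) (y + 1); mkv 1 x (y + 1);
      mkv 2 x (y + 1)].

Lemma octagon_cycle x y : cycle tsq_adj (octagon x y).
Proof. by rewrite /= /tsq_adj /= /mkv !xpair_eqE !eqxx /= ?orbT. Qed.

Definition octagon_patch (n : nat) : set tsq_vertex :=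
  [set v | exists x y : int,
     [/\ - n%:Z <= x <= n%:Z - 1, - n%:Z <= y <= n%:Z - 1
       & v \in octagon x y]].

(* fset_set is only meaningful on finite sets. *)
Lemma finite_octagon_patch n : finite_set (octagon_patch n).
Proof.
pose s := [seq (i%:Z - n%:Z : int) | i : nat <- iota 0 n.*2].
have sP (x : int) : - n%:Z <= x <= n%:Z - 1 -> x \in s.
  move=> /andP[nx xn]; apply/mapP.
  have x0 : 0 <= x + n%:Z by rewrite -lerBlDr sub0r.
  exists (absz (x + n%:Z)); last by rewrite gez0_abs // addrK.
  rewrite mem_iota add0n /= -ltz_nat gez0_abs // -addnn PoszD ltrD2r.
  by rewrite -lezD1 -lerBrDr.
apply: (@sub_finite_set _ _
  [set` flatten [seq octagon x y | x <- s, y <- s]]).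
  move=> v [x [y [/sP xs /sP ys vo]]] /=.
  apply/flattenP; exists (octagon x y) => //.
  by apply/allpairsP; exists (x, y).
exact: finite_seq.
Qed.

Definition patch_ratio (R : realType) (T : set tsq_vertex) (n : nat) : R :=
  #|` fset_set (T `&` octagon_patch n)|%:R / #|` fset_set (octagon_patch n)|%:R.

Definition has_broadcast_density (R : realType) (T : set tsq_vertex) (d : R) :
    Prop :=
  patch_ratio R T n @[n --> \oo] --> d.

(* An infimum in \bar R, hence +oo if there were no broadcast with a density. *)
Definition optimal_density (R : realType) (t r : nat) : \bar R :=
  ereal_inf [set (d%:E : \bar R) | d in
    [set d : R | exists T : set tsq_vertex,
       broadcast R tsq_adj t r T /\ has_broadcast_density T d]].

(* Main.v *)
Require Import Defs.
From mathcomp Require Import all_boot all_order all_algebra.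
From mathcomp Require Import all_classical all_reals all_analysis.
From mathcomp Require Import finmap zify ring lra.

Set Implicit Arguments.
Unset Strict Implicit.
Unset Printing Implicit Defensive.

Import Order.TTheory GRing.Theory Num.Theory.
Import numFieldNormedType.Exports.

Local Open Scope classical_set_scope.
Local Open Scope ring_scope.

(** The bound is witnessed by a periodic set [pattern] of vertices: the top
vertices of the squares with x = y mod 3 and the right vertices of the squares
with x = y + 1 mod 3.  Of any three consecutive squares in a row one
contributes its top vertex, one its right vertex and one nothing, which is 2
vertices out of 12.

It is a (3,2) broadcast because a vertex with a pattern vertex at distance at
most 1 receives at least 2 from it, and every other vertex has two distinct
pattern vertices at distance at most 2, each giving at least 1.  By periodicity
this is a check of twelve cases, the four positions in a square times the three
values of x - y mod 3 ([pattern_broadcast]).  Exact distances are never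
computed: a walk bounds the distance from above, hence the reception from below,
and all receptions summed are nonnegative ([broadcast_walks]).

For the density, the vertices of the patch B_n with a given position in their
square form a rectangle, of sides 2n and 2n+1 ([range_patch_vertex]); so B_n has
8n(2n+1) vertices.  Along each of the 2n lines of length 2n+1 of the top
rectangle and of the right rectangle, the pattern is a residue class mod 3,
which meets the line in q or q+1 points, q being the quotient of 2n+1 by 3
([sum_residue_bounds]).  The number of pattern vertices of B_n thus lies between
4nq and 4n(q+1), so that the error in the ratio 1/6 is O(1/n). *)

(** * Broadcasts certified by walks *)

Section Walks.
Variables (R : realType) (V : choiceType) (e : rel V).

Lemma graph_dist_le_walk (u : V) (p : seq V) : path e u p ->
  (graph_dist R e u (last u p) <= (size p)%:R%:E)%E.
Proof. by move=> ep; apply: ereal_inf_lbound; exists p. Qed.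

Lemma le_reception_walk (t : nat) (u : V) (p : seq V) :
  path e u p -> (size p < t)%N ->
  (((t - size p)%:R : R)%:E <= reception R e t u (last u p))%E.
Proof.
move=> ep pt; rewrite natrB ?(ltnW pt)// EFinB.
exact/leeB/graph_dist_le_walk.
Qed.

(** Since the sum of receptions has nonnegative terms, it suffices to bound from
below its restriction to finitely many broadcasting vertices; a walk to such a
vertex does so by bounding its distance.  Uniqueness of the endpoints prevents a
vertex from being counted twice. *)
Lemma broadcast_walks (t r : nat) (T : set V) :
  (forall u, exists ps : seq (seq V),
     [/\ uniq (map (last u) ps),
         forall p, p \in ps -> [/\ path e u p, T (last u p) & (size p < t)%N]
       & (r <= \sum_(p <- ps) (t - size p))%N]) ->
  broadcast R e t r T.
Proof.
move=> walks u; have [ps [ups psP rps]] := walks u.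
apply: esum_ge; exists [set` map (last u) ps].
  split=> [|v /mapP[p /psP[ep Tp pt] ->]]; first exact: finite_seq.
  split=> //; apply: le_lt_trans (graph_dist_le_walk ep) _.
  by rewrite lte_fin ltr_nat.
rewrite -fsbig_seq// big_map.
apply: (@le_trans _ _ (\sum_(p <- ps) ((t - size p)%:R : R)%:E)%E).
  by rewrite sumEFin lee_fin -natr_sum ler_nat.
rewrite big_seq [leRHS]big_seq.
by apply: lee_sum => p /psP[ep _ pt]; exact: le_reception_walk.
Qed.

(** The two ways of receiving 2 when the strength is 3: one vertex at distance at
most 1, or two at distance at most 2. *)
Lemma broadcast32_walks (T : set V) :
  (forall u,
     (exists p, [/\ path e u p, T (last u p) & (size p <= 1)%N]) \/
     (exists p q, [/\ path e u p /\ path e u q, T (last u p) /\ T (last u q),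
        (size p <= 2)%N /\ (size q <= 2)%N & last u p != last u q])) ->
  broadcast R e 3 2 T.
Proof.
move=> walks; apply: broadcast_walks => u.
case: (walks u) => [[p [ep Tp p1]]|[p [q [[ep eq] [Tp Tq] [p2 q2] pq]]]].
  exists [:: p]; split=> //=; last by rewrite big_seq1 (leq_sub2l 3 p1).
  by move=> _ /[1!inE] /eqP ->; split=> //; exact: leqW.
exists [:: p; q]; split=> /=.
- by rewrite inE pq.
- by move=> _ /[!inE] /orP[] /eqP ->.
- rewrite big_cons big_seq1.
  exact: leq_add (leq_sub2l 3 p2) (leq_sub2l 3 q2).
Qed.

End Walks.

(** * The diagonal pattern and its domination property *)

(** The residue classes are chosen so that a square without pattern vertices, one
with x - y = 2 mod 3, has them on all sides: the right vertices of the squares on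
its left and above it, the top vertices of the squares below it and on its
right. *)
Definition pattern : pred tsq_vertex := fun v =>
  let: (a, (x, y)) := v in
  (a == 0) && (3 %| x - y)%Z || (a == 1) && (3 %| x - y - 1)%Z.

(* On explicit walks, adjacency and membership in the pattern become linear
   arithmetic on the coordinates, including divisibility by 3. *)
Ltac decide_local :=
  rewrite /= ?/pattern ?/tsq_adj /= ?/mkv ?xpair_eqE /=; lia.

Lemma pattern_broadcast (R : realType) :
  broadcast R tsq_adj 3 2 [set v | pattern v].
Proof.
apply: broadcast32_walks => -[a [x y]].
have d3 : (3 %| x - y)%Z \/ (3 %| x - y - 1)%Z \/ (3 %| x - y - 2)%Z by lia.
have [] : [\/ a = 0, a = 1, a = 2 | a = 3].
  by case: a => -[|[|[|[|//]]]] ia;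
    [constructor 1|constructor 2|constructor 3|constructor 4]; exact: val_inj.
(* Goals come position by position, and within each for x - y = 0, 1, 2 mod 3. *)
all: move=> ->; case: d3 => [d|[d|d]].
- by left; exists [::]; split=> //; decide_local.
- by left; exists [:: mkv 1 x y]; split=> //; decide_local.
- by right; exists [:: mkv 2 x (y + 1); mkv 1 x (y + 1)],
    [:: mkv 3 x y; mkv 1 (x - 1) y]; split; first split; decide_local.
- by left; exists [:: mkv 0 x y]; split=> //; decide_local.
- by left; exists [::]; split=> //; decide_local.
- by right; exists [:: mkv 3 (x + 1) y; mkv 0 (x + 1) y],
    [:: mkv 2 x y; mkv 0 x (y - 1)]; split; first split; decide_local.
- by right; exists [:: mkv 1 x y; mkv 0 x y],
    [:: mkv 0 x (y - 1); mkv 1 x (y - 1)]; split; first split; decide_local.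
- by left; exists [:: mkv 1 x y]; split=> //; decide_local.
- by left; exists [:: mkv 0 x (y - 1)]; split=> //; decide_local.
- by left; exists [:: mkv 0 x y]; split=> //; decide_local.
- by right; exists [:: mkv 0 x y; mkv 1 x y],
    [:: mkv 1 (x - 1) y; mkv 0 (x - 1) y]; split; first split; decide_local.
- by left; exists [:: mkv 1 (x - 1) y]; split=> //; decide_local.
Qed.

(** * Counting along residue classes *)

Lemma sum_residue_mul (c d k : nat) : (0 < d)%N ->
  (\sum_(0 <= i < k * d) (i == c %[mod d]) = k)%N.
Proof.
move=> d0; elim: k => [|k IHk]; first by rewrite mul0n big_geq.
rewrite (@big_cat_nat _ _ _ (k * d))// ?leq_mul2r ?leqnSn ?orbT//=.
rewrite IHk -addn1; congr (_ + _)%N.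
rewrite mulnDl mul1n -{1}[(k * d)%N]add0n big_addn addKn big_mkord.
under eq_bigr do rewrite [(_ + k * d)%N]addnC modnMDl modn_small//.
rewrite (bigD1 (Ordinal (ltn_pmod c d0)))//= eqxx big1// => i.
by rewrite -val_eqE/= => /negbTE ->.
Qed.

(** The first (L %/ d) * d integers consist of full periods, each meeting the
residue class once, and one more period covers the remainder. *)
Lemma sum_residue_bounds (c d L : nat) : (0 < d)%N ->
  (L %/ d <= \sum_(i < L) (i == c %[mod d]) <= (L %/ d).+1)%N.
Proof.
move=> d0; rewrite -(big_mkord predT (fun i => nat_of_bool (i == c %[mod d]))).
have mono m m' : (m <= m')%N ->
    (\sum_(0 <= i < m) (i == c %[mod d])
       <= \sum_(0 <= i < m') (i == c %[mod d]))%N.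
  by move=> mm'; rewrite (@big_cat_nat _ _ _ m 0 m')//= leq_addr.
apply/andP; split.
  by rewrite -{1}[(L %/ d)%N](sum_residue_mul c _ d0) mono// leq_divM.
by rewrite -[leqRHS](sum_residue_mul c _ d0) mono// ltnW// ltn_ceil.
Qed.

Lemma card_fset_set_image_inj (I : finType) (V : choiceType) (f : I -> V)
    (P : pred V) : injective f ->
  #|` fset_set ([set v | P v] `&` range f)| = (\sum_i P (f i))%N.
Proof.
move=> f_inj; pose s := [seq f i | i <- enum [pred i | P (f i)]].
have -> : fset_set ([set v | P v] `&` range f) = [fset v in s]%fset.
  apply/fsetP => v; rewrite in_fset_set; last first.
    exact/finite_setIr/finite_image/finite_finset.
  rewrite in_fset /=; apply/idP/idP => [/set_mem[/= Pv [i _ fi]]|].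
    by apply/mapP; exists i; rewrite // mem_enum inE fi.
  case/mapP => i; rewrite mem_enum inE => Pfi ->.
  by apply/mem_set; split=> //; exists i.
rewrite card_fseq undup_id ?map_inj_uniq ?enum_uniq// size_map -cardE -sum1_card.
by rewrite big_mkcond; apply: eq_bigr => i _; rewrite inE; case: (P _).
Qed.

(** * The patch as four rectangles *)

(** A top or bottom vertex of the patch has 2n+1 possible abscissas and 2n
ordinates, and conversely for a right or left one; [i] runs along the long side
and [j] along the short one.  The octagons lie above and to the right of the
squares that index them, so the short range starts at -n for top and right
vertices, at -n+1 for bottom and left ones. *)
Definition patch_vertex (n : nat) (p : 'Z_4 * ('I_n.*2 * 'I_n.*2.+1)) :
    tsq_vertex :=
  let: (a, (j, i)) := p in
  let l := i%:Z - n%:Z in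
  let s := j%:Z - n%:Z + (1 < a)%N%:Z in
  if odd a then mkv a s l else mkv a l s.

Lemma patch_vertex_inj n : injective (@patch_vertex n).
Proof.
move=> [a [j i]] [a' [j' i']]; rewrite /patch_vertex.
move=> E; have aa' : a = a' by move: E; do 2![case: odd] => -[].
rewrite -{a'}aa' in E *; congr (_, (_, _)); apply: val_inj => /=;
  by move: E; case: odd => -[] => *; lia.
Qed.

Lemma range_patch_vertex n : range (@patch_vertex n) = octagon_patch n.
Proof.
apply/seteqP; split.
  move=> _ [[a [j i]] _ <-].
  (* An octagon covers two consecutive values of the long coordinate: the last
     value 2n has to use the octagon just before it. *)
  pose l := i%:Z - n%:Z - (i == n.*2 :> nat)%:Z; pose s := j%:Z - n%:Z.
  have lP : - n%:Z <= l <= n%:Z - 1.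
    by have := (ltn_ord i, ltn_ord j); rewrite /l; case: eqP => /= ? [? ?]; lia.
  have sP : - n%:Z <= s <= n%:Z - 1 by have := ltn_ord j; rewrite /s; lia.
  exists (if odd a then s else l), (if odd a then l else s).
  split; [by case: odd | by case: odd |].
  rewrite /octagon !inE /l /s.
  case: a => -[|[|[|[|//]]]] ia; rewrite /= /mkv !xpair_eqE /=;
    case: (i == _ :> nat); lia.
have long (z : int) : - n%:Z <= z <= n%:Z ->
    exists i : 'I_n.*2.+1, z = i%:Z - n%:Z.
  move=> zn; have iP : (absz (z + n%:Z)%R < n.*2.+1)%N by lia.
  by exists (Ordinal iP) => /=; lia.
have short (z : int) : - n%:Z <= z <= n%:Z - 1 ->
    exists j : 'I_n.*2, z = j%:Z - n%:Z.
  move=> zn; have jP : (absz (z + n%:Z)%R < n.*2)%N by lia.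
  by exists (Ordinal jP) => /=; lia.
move=> v [x [y [xn yn]]].
have [jx jxE] := short _ xn; have [jy jyE] := short _ yn.
have [|ix ixE] := long x; first lia.
have [|iy iyE] := long y; first lia.
have [|ix1 ix1E] := long (x + 1); first lia.
have [|iy1 iy1E] := long (y + 1); first lia.
rewrite /octagon !inE => /or4P[|||/or4P[|||/orP[]]] /eqP->.
- by exists (0, (jy, ix)) => //=; rewrite /mkv; congr (_, (_, _)); lia.
- by exists (1, (jx, iy)) => //=; rewrite /mkv; congr (_, (_, _)); lia.
- by exists (3, (jx, iy)) => //=; rewrite /mkv; congr (_, (_, _)); lia.
- by exists (0, (jy, ix1)) => //=; rewrite /mkv; congr (_, (_, _)); lia.
- by exists (2, (jy, ix1)) => //=; rewrite /mkv; congr (_, (_, _)); lia.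
- by exists (3, (jx, iy1)) => //=; rewrite /mkv; congr (_, (_, _)); lia.
- by exists (1, (jx, iy1)) => //=; rewrite /mkv; congr (_, (_, _)); lia.
- by exists (2, (jy, ix)) => //=; rewrite /mkv; congr (_, (_, _)); lia.
Qed.

Lemma card_octagon_patch n :
  #|` fset_set (octagon_patch n)| = (8 * n * n.*2.+1)%N.
Proof.
have -> : octagon_patch n = [set v | predT v] `&` range (@patch_vertex n).
  by rewrite range_patch_vertex; apply/seteqP; split=> [v|v []].
rewrite (card_fset_set_image_inj predT (@patch_vertex_inj n)).
rewrite sum_nat_const !card_prod !card_ord -[(Zp_trunc 4).+2]/4%N; lia.
Qed.

Lemma card_pattern_patch n (c := #|` fset_set ([set v | pattern v] `&`
    octagon_patch n)|) (q := (n.*2.+1 %/ 3)%N) :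
  (4 * n * q <= c <= 4 * n * q.+1)%N.
Proof.
rewrite /c -range_patch_vertex (card_fset_set_image_inj _ (@patch_vertex_inj n)).
pose N (a : 'Z_4) := (\sum_ji pattern (@patch_vertex n (a, ji)))%N.
have -> : (\sum_p pattern (@patch_vertex n p) = \sum_a N a)%N.
  by rewrite pair_bigA; apply: eq_bigr => -[].
have N_bounds a : (forall j, exists r, forall i,
      pattern (@patch_vertex n (a, (j, i))) = (i == r %[mod 3])) ->
    (n.*2 * q <= N a <= n.*2 * q.+1)%N.
  move=> aP; have -> : N a = (\sum_(j < n.*2) \sum_(i < n.*2.+1)
      pattern (patch_vertex (a, (j, i))))%N.
    by rewrite pair_bigA; apply: eq_bigr => -[].
  have row j : (q <= \sum_(i < n.*2.+1) pattern (patch_vertex (a, (j, i)))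
                  <= q.+1)%N.
    have [r rP] := aP j; under eq_bigr do rewrite rP.
    exact: sum_residue_bounds.
  have sumE k : (n.*2 * k = \sum_(j < n.*2) k)%N.
    by rewrite sum_nat_const card_ord.
  by rewrite !sumE; apply/andP; split; apply: leq_sum => j _;
    have /andP[] := row j.
have N_eq0 (a : 'Z_4) : (1 < a)%N -> N a = 0%N.
  move=> a1; apply: big1 => -[j i] _.
  by move: a1; case: a => -[|[|[|[|//]]]].
have -> : (\sum_a N a = N 0%R + N 1%R)%N.
  rewrite (bigD1 0)//= (bigD1 1)//= big1 ?addn0// => -[[|[|a]] ia]//= _.
  exact: N_eq0.
have /andP[l0 u0] : (n.*2 * q <= N 0%R <= n.*2 * q.+1)%N.
  apply: N_bounds => j; exists j => i.
  by rewrite /= /pattern /mkv /=; lia.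
have /andP[l1 u1] : (n.*2 * q <= N 1%R <= n.*2 * q.+1)%N.
  (* Right vertices: j - i - 1 = 0 mod 3, that is i = j + 2 mod 3. *)
  apply: N_bounds => j; exists (j + 2)%N => i.
  by rewrite /= /pattern /mkv /=; lia.
have mulE k : (4 * n * k = n.*2 * k + n.*2 * k)%N by lia.
by rewrite !mulE !leq_add.
Qed.

(** * The density of the pattern *)

Lemma pattern_ratio_error (R : realType) (n : nat) :
  `|patch_ratio R [set v | pattern v] n - 1 / 6| <= harmonic n.
Proof.
rewrite /patch_ratio card_octagon_patch /harmonic /=.
have := card_pattern_patch n; set c := #|` _|.
case: n @c => [|n] c /andP[cl cu].
  (* The patch is empty and the ratio is 0 by convention. *)
  by rewrite muln0 mul0n invr0 mulr0 sub0r normrN ger0_norm; lra.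
set m := n.+1 in c cl cu *; set D := (8 * m * m.*2.+1)%N.
set q := (m.*2.+1 %/ 3)%N in cl cu.
(* Since 4mq <= c <= 4m(q+1) and 3q <= 2m+1 <= 3(q+1), |6c - D| <= 24m. *)
have := leq_mul (leqnn (8 * m)%N) (leq_divM m.*2.+1 3).
have := leq_mul (leqnn (8 * m)%N) (ltnW (ltn_ceil m.*2.+1 (isT : 0 < 3)%N)).
rewrite -/q -/D => Dq qD.
have cD : (6 * c <= D + 24 * m)%N by clearbody D q c; lia.
have Dc : (D <= 6 * c + 24 * m)%N by clearbody D q c; lia.
have D0 : (0 : R) < D%:R by rewrite ltr0n.
have mD : (24 * m)%:R <= 6 * (D%:R / m.+1%:R) :> R.
  rewrite mulrA ler_pdivlMr ?ltr0n// -natrM -natrM ler_nat /D; nia.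
move: cD Dc.
rewrite -!(ler_nat R) (natrD _ D) (natrD _ (6 * c)%N) (natrM _ 6 c) => cD Dc.
have -> : c%:R / D%:R - 1 / 6 = (6 * c%:R - D%:R) / (6 * D%:R) :> R.
  by field; rewrite gt_eqF.
rewrite normrM [X in _ * X]gtr0_norm ?invr_gt0 ?mulr_gt0//.
rewrite ler_pdivrMr ?mulr_gt0// mulrCA [m.+1%:R^-1 * _]mulrC.
apply: le_trans mD; rewrite ler_norml; apply/andP; split; lra.
Qed.

Lemma pattern_density (R : realType) :
  has_broadcast_density [set v | pattern v] (1 / 6 : R).
Proof.
apply: (@squeeze_cvgr _ _ _ _ (fun n => 1 / 6 - @harmonic R n)
                              (fun n => 1 / 6 + @harmonic R n)).
- by near=> n; rewrite -ler_distl; exact: pattern_ratio_error.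
- rewrite -[X in _ --> X]subr0.
  by apply: cvgB; [exact: cvg_cst|exact: cvg_harmonic].
- rewrite -[X in _ --> X]addr0.
  by apply: cvgD; [exact: cvg_cst|exact: cvg_harmonic].
Unshelve. all: by end_near. Qed.

Theorem theorem4p5 (R : realType) :
  (optimal_density R 3 2 <= (1 / 6)%R%:E)%E.
Proof.
apply: ereal_inf_lbound; exists (1 / 6) => //.
exists [set v | pattern v]; split.
- exact: pattern_broadcast.
- exact: pattern_density.
Qed.
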